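(* Every $2$-dimensional subspace $X$ of $\ell_\infty^3(\mathbb{C})$ has Property Q, that is, $\|B\|_\pi=\|B\|_\epsilon$ for all non-negative definite $B\in X\otimes X$.
   Context: $\ell_\infty^3(\mathbb{C})$ is $\mathbb{C}^3$ with the maximum norm, and $X$ carries the inherited norm. With $e_1,e_2$ a chosen basis of $X$, an element $B=\sum_{i,j=1}^2 b_{ij}\,e_i\otimes e_j$ of $X\otimes X$ is non-negative definite if the matrix $(b_{ij})$ is (Hermitian) non-negative definite; equivalently, $B$ lies in the convex hull of the tensors $x\otimes\bar x$, $x\in X$, where $\bar x=\sum_i\bar x_ie_i$ for $x=\sum_i x_ie_i$. The basis is the one in the following identification: up to isometries of $\ell_\infty^3(\mathbb{C})$, every $2$-dimensional subspace has a basis of the form $\{(1,0,a_1),(0,1,a_2)\}$ with $a_1,a_2\in\mathbb{C}$, and is thereby isometric to $\mathbb{C}^2$ with the norm $\max\{|z_1|,|z_2|,|a_1z_1+a_2z_2|\}$. An element $B\in X\otimes X$ defines a linear map $X^*\to X$ by $B(\lambda)=\sum_{i,j}b_{ij}\lambda(e_i)e_j$. The injective norm is $\|B\|_\epsilon=\sup\{\|B(\lambda)\|_X:\lambda\in X^*,\ \|\lambda\|_{X^*}=1\}$. The projective norm is $\|B\|_\pi=\inf\{\sum_{k=1}^N\|v_k\|_X\|w_k\|_X : B=\sum_{k=1}^N v_k\otimes w_k,\ v_k,w_k\in X,\ N\in\mathbb{N}\}$. A finite-dimensional normed space $X$ has Property Q if $\|B\|_\pi=\|B\|_\epsilon$ for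 all non-negative definite $B\in X\otimes X$.
   Formalization: The basis defining non-negative definiteness is a suitably chosen one of those that an isometry carries to {(1,0,a_1),(0,1,a_2)}: each X has such a basis with Property Q. For every such basis the claim fails, e.g. a_1=1, a_2=i, B=e_1⊗e_1+e_2⊗e_2. *)

(* Defs.v *)
From HB Require Import structures.
From mathcomp Require Import all_boot all_order all_algebra.
From mathcomp Require Import all_classical all_reals all_analysis.
From mathcomp.real_closed Require Import complex.

Set Implicit Arguments.
Unset Strict Implicit.
Unset Printing Implicit Defensive.

Import Order.TTheory GRing.Theory Num.Theory.
Import numFieldNormedType.Exports.

Local Open Scope classical_set_scope.
Local Open Scope ring_scope.
Local Open Scope complex_scope.

(* The library norm `|z| on R[i], and the maximum norm it induces on
   'rV[R[i]]_n, take their values in the nonnegative reals of R[i]; we take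
   their real parts in order to form sup and inf in R. *)
Definition rnorm (R : realType) (V : normedZmodType R[i]) (x : V) : R :=
  complex.Re `|x|.

Section Subspace.
Variables (R : realType) (n : nat) (X : {vspace 'rV[R[i]]_n}).

Definition subnorm (x : subvs_of X) : R := rnorm (vsval x).

Definition dual := 'Hom(subvs_of X, (R[i])^o).

Definition dual_norm (lambda : dual) : R :=
  sup [set r | exists2 x : subvs_of X,
                 subnorm x <= 1 & r = rnorm (lambda x : R[i])].

(* X (x) X is realized inside C^n (x) C^n, identified with the n x n matrices
   so that v (x) w is the matrix with entries v_i w_j (no conjugation). *)
Definition tens (v w : subvs_of X) : 'M[R[i]]_n :=
  (vsval v)^T *m vsval w.

Definition tensor_of k (e : k.-tuple (subvs_of X)) (b : 'M[R[i]]_k) :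
    'M[R[i]]_n :=
  \sum_i \sum_j b i j *: tens (tnth e i) (tnth e j).

Definition tensor_app k (e : k.-tuple (subvs_of X)) (b : 'M[R[i]]_k)
    (lambda : dual) : subvs_of X :=
  \sum_i \sum_j (b i j * lambda (tnth e i)) *: tnth e j.

Definition injective_norm k (e : k.-tuple (subvs_of X)) (b : 'M[R[i]]_k) : R :=
  sup [set r | exists2 lambda : dual,
                 dual_norm lambda = 1 & r = subnorm (tensor_app e b lambda)].

Definition projective_norm (B : 'M[R[i]]_n) : R :=
  inf [set r | exists N (v w : 'I_N -> subvs_of X),
                 B = \sum_k tens (v k) (w k) /\
                 r = \sum_k subnorm (v k) * subnorm (w k)].

End Subspace.

Definition nonneg_definite (R : realType) k (b : 'M[R[i]]_k) : Prop :=
  b \is hermsymmx /\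
  forall x : 'rV[R[i]]_k, 0 <= (x *m b *m (map_mx Num.conj x)^T) 0 0.

(* Non-negative definiteness of an element of X (x) X depends on the basis e
   (a change of basis P turns b into P^T b P, not P^* b P), hence so does
   Property Q. *)
Definition property_Q (R : realType) n (X : {vspace 'rV[R[i]]_n}) k
    (e : k.-tuple (subvs_of X)) : Prop :=
  forall b : 'M[R[i]]_k, nonneg_definite b ->
    projective_norm X (tensor_of e b) = injective_norm e b.

Definition vec3 (R : realType) (x y z : R[i]) : 'rV[R[i]]_3 :=
  \row_(i < 3) [:: x; y; z]`_i.

Definition standard_basis (R : realType) (X : {vspace 'rV[R[i]]_3})
    (e : 2.-tuple (subvs_of X)) : Prop :=
  basis_of {: subvs_of X} e /\
  exists (U : {linear 'rV[R[i]]_3 -> 'rV[R[i]]_3}) (a1 a2 : R[i]),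
    [/\ forall x, `|U x| = `|x|,
        U (vsval (tnth e ord0)) = vec3 1 0 a1
      & U (vsval (tnth e ord_max)) = vec3 0 1 a2].

(* Main.v *)
(* A suitable permutation and phases turn the defining equation of [X] into one
   with coefficients [a1, a2 >= 0], so that the norm is the maximum of
   [|z1|, |z2|, |a1 z1 + a2 z2|], where the three functionals [f] are real in the
   basis [e].  A non-negative definite [b] of size 2 has
   [(Re b01)^2 + (Im b01)^2 <= b00 b11], so that shrinking [|Im b01|] moves it away
   from the rank one matrices with the same diagonal and [Re b01]; these are
   [z z^*] and its conjugate, hence [b] is a convex combination of the two.  A
   real [f] takes the same value [|f(z)|^2] on both and hence on [b]: choosing [f]
   with [|f(z)|] equal to the norm of [z], the decomposition and the functional
   [f] show that both norms of [b] equal the square of the norm of [z]. *)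
Require Import Defs.
From HB Require Import structures.
From mathcomp Require Import all_boot all_order all_algebra.
From mathcomp Require Import all_classical all_reals all_analysis.
From mathcomp.real_closed Require Import complex.
From mathcomp Require Import perm ring lra.

Set Implicit Arguments.
Unset Strict Implicit.
Unset Printing Implicit Defensive.

Import Order.TTheory GRing.Theory Num.Theory.
Import numFieldNormedType.Exports.

Local Open Scope classical_set_scope.
Local Open Scope ring_scope.
Local Open Scope complex_scope.

(** * Entrywise bounds for the maximum norm *)

Section MatrixNorm.
Variables (K : numDomainType) (m n : nat) (x : 'M[K]_(m, n)).

Lemma mx_norm_ge_entry i j : `|x i j| <= mx_norm x.
Proof.
rewrite mx_normE -[leLHS]nngE num_le.
exact: (le_bigmax _ (fun ij : 'I_m * 'I_n => `|x ij.1 ij.2|%:nng) (i, j)).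
Qed.

Lemma mx_norm_le r : 0 <= r -> (forall i j, `|x i j| <= r) -> mx_norm x <= r.
Proof.
move=> r0 xr; have [->//|/mx_norm_neq0[i ->]] := eqVneq (mx_norm x) 0.
exact: xr.
Qed.

End MatrixNorm.

(** * Real-valued norms over the complex numbers *)

Section RealNorm.
Variables (R : realType).
Implicit Types (z : R[i]).

Lemma rnormC (V : normedZmodType R[i]) (x : V) : (rnorm x)%:C = `|x|.
Proof. by rewrite RRe_real // normr_real. Qed.

Lemma rnorm_ge0 (V : normedZmodType R[i]) (x : V) : 0 <= rnorm x.
Proof. by rewrite -lecR rnormC normr_ge0. Qed.

Lemma rnorm0_eq0 (V : normedZmodType R[i]) (x : V) : rnorm x = 0 -> x = 0.
Proof. by move=> x0; apply/eqP; rewrite -normr_eq0 -rnormC x0. Qed.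

Lemma ler_rnorm_sum (V : normedZmodType R[i]) (I : finType) (F : I -> V) :
  rnorm (\sum_i F i) <= \sum_i rnorm (F i).
Proof.
rewrite -lecR rnormC rmorph_sum (eq_bigr (fun i => `|F i|)) ?ler_norm_sum //.
by move=> i _; rewrite -rnormC.
Qed.

Lemma rnormM z1 z2 : rnorm (z1 * z2) = rnorm z1 * rnorm z2.
Proof. by apply: complexI; rewrite rmorphM /= !rnormC normrM. Qed.

Lemma rnormZ m n z (x : 'M[R[i]]_(m, n)) : rnorm (z *: x) = rnorm z * rnorm x.
Proof. by apply: complexI; rewrite rmorphM /= !rnormC mx_normZ. Qed.

Lemma rnorm_real (r : R) : 0 <= r -> rnorm (r%:C : R[i]) = r.
Proof. by move=> r0; apply: complexI; rewrite rnormC ger0_norm // ler0c. Qed.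

Lemma mx_rnorm_le m n (x : 'M[R[i]]_(m, n)) i j : rnorm (x i j) <= rnorm x.
Proof.
by rewrite -lecR !rnormC; exact: mx_norm_ge_entry.
Qed.

Lemma mx_rnorm_ub m n (x : 'M[R[i]]_(m, n)) (r : R) :
  0 <= r -> (forall i j, rnorm (x i j) <= r) -> rnorm x <= r.
Proof.
move=> r0 xr; rewrite -lecR rnormC; apply: mx_norm_le; first by rewrite ler0c.
by move=> i j; rewrite -rnormC lecR.
Qed.

End RealNorm.

(** * Dual norms, tensors, and the comparison of the two tensor norms *)

Section Duality.
Variables (R : realType) (n : nat) (X : {vspace 'rV[R[i]]_n}).
Implicit Types (x v w : subvs_of X) (lambda : dual X).

Lemma subnormZ z x : subnorm (z *: x) = rnorm z * subnorm x.
Proof. by rewrite /subnorm linearZ rnormZ. Qed.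

Lemma subnorm_ge0 x : 0 <= subnorm x.
Proof. exact: rnorm_ge0. Qed.

Lemma subnorm0 : subnorm (0 : subvs_of X) = 0.
Proof. by rewrite -(scale0r 0) subnormZ /rnorm normr0 mul0r. Qed.

Local Notation dual_values lambda :=
  [set r | exists2 x : subvs_of X, subnorm x <= 1 & r = rnorm (lambda x : R[i])].

(** [sup] takes the default value 0 on an unbounded set, so a functional of dual norm 1 is
    automatically bounded, without any compactness argument. *)
Lemma dual_norm_neq0 lambda :
  dual_norm lambda != 0 -> has_ubound (dual_values lambda).
Proof.
move=> l0; apply: contrapT => h; case/eqP: l0; apply: sup_out.
by case=> _ /h.
Qed.

Lemma dual_norm_ub lambda r :
  (forall x, subnorm x <= 1 -> rnorm (lambda x : R[i]) <= r) ->
  dual_norm lambda <= r.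
Proof.
move=> lr; apply: ge_sup => [|_ [x x1 ->]]; last exact: lr.
by exists (rnorm (lambda 0 : R[i])); exists 0; rewrite ?subnorm0 ?ler01.
Qed.

Lemma le_dual_norm lambda x : has_ubound (dual_values lambda) ->
  rnorm (lambda x : R[i]) <= dual_norm lambda * subnorm x.
Proof.
move=> lub; have [x0|x0] := eqVneq (subnorm x) 0.
  have -> : x = 0 by apply: val_inj; rewrite linear0; apply: rnorm0_eq0.
  by rewrite linear0 subnorm0 mulr0 /rnorm normr0.
have xp : 0 < subnorm x by rewrite lt_def x0 subnorm_ge0.
rewrite -ler_pdivrMr //; apply: ub_le_sup => //.
exists ((subnorm x)^-1%:C *: x).
  by rewrite subnormZ rnorm_real ?invr_ge0 ?subnorm_ge0 // mulVf ?lexx.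
by rewrite linearZ rnormM rnorm_real ?invr_ge0 ?subnorm_ge0 // mulrC.
Qed.

Lemma dual_normZ (c : R) lambda : 0 < c -> has_ubound (dual_values lambda) ->
  dual_norm (c%:C *: lambda) = c * dual_norm lambda.
Proof.
move=> c0 lub.
have cE x :
    rnorm ((c%:C *: lambda) x : R[i]) = c * rnorm (lambda x : R[i]).
  by rewrite lfunE rnormM rnorm_real ?ltW.
have ub x : subnorm x <= 1 ->
    rnorm ((c%:C *: lambda) x : R[i]) <= c * dual_norm lambda.
  by move=> x1; rewrite cE ler_pM2l //; apply: ub_le_sup => //; exists x.
apply: le_anti; rewrite dual_norm_ub //= -ler_pdivlMl //.
rewrite dual_norm_ub // => x x1.
rewrite ler_pdivlMl // -cE; apply: ub_le_sup; last by exists x.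
by exists (c * dual_norm lambda) => _ [y y1 ->]; apply: ub.
Qed.

Lemma tensZl z v w : tens (z *: v) w = z *: tens v w.
Proof. by rewrite /tens linearZ -scalemxAl. Qed.

Lemma tens_sum k (e : k.-tuple (subvs_of X)) (y z : 'I_k -> R[i]) :
  tens (\sum_i y i *: tnth e i) (\sum_i z i *: tnth e i) =
  tensor_of e (\matrix_(i, j) (y i * z j)).
Proof.
rewrite /tensor_of /tens !(linear_sum vsval) (linear_sum trmx) mulmx_suml.
apply: eq_bigr => i _.
rewrite mulmx_sumr; apply: eq_bigr => j _.
by rewrite mxE !linearZ /= -scalemxAl scalerA mulrC.
Qed.

(** Contracting the first factor with [lambda] is left multiplication by a row: [lambda] is extended
    to the whole space through the projection [vsproj X]. *)
Lemma tens_app lambda :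
  exists L : 'rV[R[i]]_n, forall v w, L *m tens v w = lambda v *: vsval w.
Proof.
exists (\row_i lambda (vsproj X (delta_mx 0 i))) => v w.
rewrite /tens mulmxA [X in X *m _]mx11_scalar mul_scalar_mx; congr (_ *: _).
rewrite -[in RHS](vsvalK v) [in RHS](row_sum_delta (vsval v)) !linear_sum mxE.
by apply: eq_bigr => i _; rewrite !mxE !linearZ mulrC.
Qed.

(** The map defined by the coefficients [b] depends only on the tensor, since it is a contraction by
    a fixed row; any decomposition may thus be used to evaluate it. *)
Lemma tensor_appE k (e : k.-tuple (subvs_of X)) b N (v w : 'I_N -> subvs_of X)
    lambda :
  tensor_of e b = \sum_i tens (v i) (w i) ->
  tensor_app e b lambda = \sum_i (lambda (v i) : R[i]) *: w i.
Proof.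
move=> eB; have [L LE] := tens_app lambda.
apply: val_inj; rewrite !linear_sum /=.
under eq_bigr do rewrite linear_sum.
rewrite [RHS](_ : _ = \sum_i L *m tens (v i) (w i)); last first.
  by apply: eq_bigr => i _; rewrite LE.
rewrite -mulmx_sumr -eB /tensor_of mulmx_sumr.
apply: eq_bigr => i _; rewrite mulmx_sumr; apply: eq_bigr => j _.
by rewrite -scalemxAr LE scalerA linearZ.
Qed.

(** Weak duality: each functional of norm 1 gives a value below the cost of each decomposition. A
    pair with the reverse inequality is therefore optimal on both sides. *)
Lemma norms_eq k (e : k.-tuple (subvs_of X)) b N (v w : 'I_N -> subvs_of X)
    lambda :
  tensor_of e b = \sum_i tens (v i) (w i) -> dual_norm lambda = 1 ->
  \sum_i subnorm (v i) * subnorm (w i) <= subnorm (tensor_app e b lambda) ->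
  projective_norm X (tensor_of e b) = injective_norm e b.
Proof.
move=> eB l1 vw_le; rewrite /projective_norm /injective_norm.
have inj_le mu N' (v' w' : 'I_N' -> subvs_of X) : dual_norm mu = 1 ->
    tensor_of e b = \sum_i tens (v' i) (w' i) ->
    subnorm (tensor_app e b mu) <= \sum_i subnorm (v' i) * subnorm (w' i).
  move=> mu1 eB'; have mu0 : dual_norm mu != 0 by rewrite mu1 oner_neq0.
  rewrite (tensor_appE _ eB') /subnorm linear_sum.
  apply: le_trans (ler_rnorm_sum _) _; apply: ler_sum => i _.
  rewrite linearZ rnormZ ler_wpM2r ?rnorm_ge0 //.
  by have := le_dual_norm (v' i) (dual_norm_neq0 mu0); rewrite mu1 mul1r.
set P := (X in inf X); set E := (X in sup X).
have Eub : ubound E (\sum_i subnorm (v i) * subnorm (w i)).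
  by move=> _ [mu mu1 ->]; apply: inj_le.
have Plb : lbound P (subnorm (tensor_app e b lambda)).
  by move=> _ [N' [v' [w' [eB' ->]]]]; apply: inj_le.
have El : E (subnorm (tensor_app e b lambda)) by exists lambda.
have Pvw : P (\sum_i subnorm (v i) * subnorm (w i)) by exists N, v, w.
apply: le_anti; apply/andP; split.
  apply: le_trans (ge_inf _ Pvw) _; first by eexists; exact: Plb.
  by apply: le_trans vw_le _; apply: ub_le_sup => //; eexists; exact: Eub.
apply: le_trans (ge_sup _ Eub) _; first by eexists; exact: El.
by apply: le_trans vw_le _; apply: lb_le_inf => //; eexists; exact: Pvw.
Qed.

(* The hypotheses say that the norm of [X] is the complexification of a real
   norm on the real span of [e]. *)
Lemma real_norming_norms_eq k (e : k.-tuple (subvs_of X)) (b : 'M[R[i]]_k)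
    (I : Type) (f : I -> dual X) (y0 : subvs_of X) (z : 'I_k -> R[i]) (t : R) :
  (forall m i, conjc (f m (tnth e i) : R[i]) = f m (tnth e i)) ->
  (forall m x, rnorm (f m x : R[i]) <= subnorm x) ->
  (forall x, exists m, subnorm x = rnorm (f m x : R[i])) ->
  y0 != 0 -> 0 <= t <= 1 ->
  (forall i j,
    b i j = t%:C * (z i * conjc (z j)) + (1 - t)%:C * (conjc (z i) * z j)) ->
  projective_norm X (tensor_of e b) = injective_norm e b.
Proof.
move=> f_real f_le f_max y0_neq0 /andP[t0 t1] bE.
have t1' : 0 <= 1 - t by rewrite subr_ge0.
pose x := \sum_i z i *: tnth e i; pose x' := \sum_i conjc (z i) *: tnth e i.
(* Since [f m] is real on the basis, conjugating coordinates conjugates its values; hence [x'] and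
   [x] have the same norm. *)
have fx' m : f m x' = conjc (f m x : R[i]).
  rewrite !linear_sum; apply: eq_bigr => i _.
  by rewrite !linearZ /= -{1}f_real [RHS](rmorphM (@conjc R)).
have x'x : subnorm x' <= subnorm x.
  by have [m ->] := f_max x'; rewrite fx' /rnorm normcJ -/(rnorm _) f_le.
(* The norming functional will be normalized, so it must not vanish. If [x] is 0, every functional
   norms it, and [y0] supplies a nonzero one. *)
have [m [y ym xm]] : exists m,
    exists2 y, f m y != 0 & subnorm x = rnorm (f m x : R[i]).
  have [x0|x0] := eqVneq x 0.
    have [m ym] := f_max y0; exists m, y0.
      apply: contraNneq y0_neq0 => fy0; apply/eqP/val_inj/rnorm0_eq0.
      by rewrite -/(subnorm _) ym fy0 /rnorm normr0.
    by rewrite x0 linear0 subnorm0 /rnorm normr0.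
  have [m xm] := f_max x; exists m, x => //.
  apply: contraNneq x0 => fx0; apply/eqP/val_inj/rnorm0_eq0.
  by rewrite -/(subnorm _) xm fx0 /rnorm normr0.
pose s := dual_norm (f m).
have fub : has_ubound (dual_values (f m)).
  by exists 1 => _ [w w1 ->]; apply: le_trans (f_le _ _) w1.
have s1 : s <= 1 by apply: dual_norm_ub => w; apply: le_trans (f_le _ _).
have s0 : 0 < s.
  have fy : 0 < rnorm (f m y : R[i]).
    by rewrite lt_def rnorm_ge0 andbT; apply: contraNneq ym => /rnorm0_eq0 ->.
  rewrite ltNge; apply/negP => s0; move: fy; rewrite ltNge => /negP; apply.
  by apply: le_trans (le_dual_norm y fub) _; rewrite mulr_le0_ge0 ?subnorm_ge0.
(* The decomposition is [t] times x tensor x' plus [1 - t] times x' tensor x, of cost at most the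
   square of the norm of [x]. *)
pose v := fun i : 'I_2 => if i == ord0 then t%:C *: x else (1 - t)%:C *: x'.
pose w := fun i : 'I_2 => if i == ord0 then x' else x.
have eB : tensor_of e b = \sum_i tens (v i) (w i).
  rewrite !big_ord_recl big_ord0 /v /w /= addr0 !tensZl !tens_sum.
  rewrite !scaler_sumr -big_split; apply: eq_bigr => i _.
  rewrite !scaler_sumr -big_split; apply: eq_bigr => j _.
  by rewrite /= bE !mxE !scalerA -scalerDl.
apply: (norms_eq (lambda := (s^-1)%:C *: f m) eB).
  by rewrite dual_normZ ?invr_gt0 // mulVf // gt_eqF.
(* Both summands contribute the same product of [f m x] and [f m x'], so the weights add up to 1. *)
have fB :
    f m (tensor_app e b ((s^-1)%:C *: f m)) = (s^-1)%:C * (f m x * f m x').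
  rewrite (tensor_appE _ eB) linear_sum !big_ord_recl big_ord0 /v /w /=.
  rewrite !lfunE /= !linearZ /= !fx' /GRing.scale /=.
  rewrite addr0 rmorphB rmorph1; set u : R[i] := f m x.
  by rewrite -[(_ * _ * _ : R[i])]/(t%:C * ((s^-1)%:C * u) * conjc u); ring.
have sN : 0 <= s^-1 by rewrite invr_ge0 ltW.
(* Testing with [f m] once more gives the lower bound [s^-1] times the square of the norm of [x],
   and [s <= 1]. *)
apply: le_trans (f_le m _); rewrite fB !rnormM fx' -xm (rnorm_real sN).
rewrite !big_ord_recl big_ord0 /v /w /= addr0 !subnormZ !rnorm_real //.
rewrite [X in _ * (_ * X)](_ : _ = subnorm x); last by rewrite xm /rnorm normcJ.
have x0 := subnorm_ge0 x; apply: (@le_trans _ _ (subnorm x * subnorm x)).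
  have : subnorm x * subnorm x' <= subnorm x * subnorm x by rewrite ler_wpM2l.
  by lra.
by rewrite ler_peMl ?mulr_ge0 // invf_ge1.
Qed.

End Duality.

(** * Non-negative definite matrices of size 2 as mixtures of a rank one matrix and its conjugate *)

Section Factorization.
Variable R : realType.

Lemma ord2_cases (i : 'I_2) : i = ord0 \/ i = ord_max.
Proof. by case: i => [[|[|//]]] ?; [left|right]; apply: val_inj. Qed.

(** For [A > 0], evaluate at [s = - A^-1]. For [A = 0] the polynomial is affine, and a positive [D]
    would let it take the value -1. *)
Lemma psd_real_det (A C D : R) :
  0 <= A -> (forall s, 0 <= A * D * s ^+ 2 + 2 * D * s + C) -> D <= A * C.
Proof.
rewrite le0r => /orP[/eqP->|A0] H.
  rewrite mul0r leNgt; apply/negP => D0.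
  have := H (- (C + 1) / (2 * D)).
  have -> : 0 * D * (- (C + 1) / (2 * D)) ^+ 2 + 2 * D * (- (C + 1) / (2 * D))
            + C = -1.
    by field; rewrite gt_eqF.
  by lra.
have := H (- A^-1).
have -> : A * D * (- A^-1) ^+ 2 + 2 * D * (- A^-1) + C = (A * C - D) / A.
  by field; rewrite gt_eqF.
by rewrite pmulr_lge0 ?invr_gt0 // subr_ge0.
Qed.

Lemma psd2_entries (b : 'M[R[i]]_2) : nonneg_definite b ->
  exists A C p q : R, [/\ 0 <= A, 0 <= C, p ^+ 2 + q ^+ 2 <= A * C &
    [/\ b 0 0 = A%:C, b 1 1 = C%:C, b 0 1 = p +i* q & b 1 0 = p -i* q]].
Proof.
case=> bH bP.
have bJ i j : b i j = conjc (b j i).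
  move/is_hermitianmxP: bH => /matrixP/(_ i j); rewrite !mxE => {1}->.
  by rewrite expr0 mul1r.
have quad c d : 0 <= (c * b 0 0 + d * b 1 0) * conjc c
                   + (c * b 0 1 + d * b 1 1) * conjc d.
  have := bP (\row_i if i == 0 then c else d).
  rewrite !mxE !big_ord_recl big_ord0 !mxE !big_ord_recl !big_ord0 !mxE /= !addr0.
  by have -> : lift ord0 ord0 = 1 :> 'I_2 by apply: val_inj.
have eA := bJ 0 0; have eC := bJ 1 1; have eB := bJ 1 0.
move: eA eC eB quad.
case: (b 0 0) => A A'; case: (b 1 1) => C C'.
case: (b 0 1) => p q -[A0] [C0] -> quad.
have {}A0 : A' = 0 by lra.
have {}C0 : C' = 0 by lra.
rewrite {A'}A0 {C'}C0 in quad *.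
have A0 : 0 <= A.
  by have := quad 1 0; rewrite lecE /= => /andP[_]; congr (_ <= _); ring.
have C0 : 0 <= C.
  by have := quad 0 1; rewrite lecE /= => /andP[_]; congr (_ <= _); ring.
exists A, C, p, q; split=> //; apply: psd_real_det => // s.
(* This test vector aligns the phase of the cross terms, leaving the polynomial of [psd_real_det]
   with [D = p ^+ 2 + q ^+ 2]. *)
have := quad (s%:C * (p -i* q)) 1; rewrite lecE /= => /andP[_].
by congr (_ <= _); ring.
Qed.

Lemma psd2_factor (b : 'M[R[i]]_2) : nonneg_definite b ->
  exists (z : 'I_2 -> R[i]) (t : R), 0 <= t <= 1 /\
    forall i j,
      b i j = t%:C * (z i * conjc (z j)) + (1 - t)%:C * (conjc (z i) * z j).
Proof.
move=> /psd2_entries[A [C [p [q [A0 C0 D [bA bC bp bq]]]]]].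
(* Mixing [p +i* r] and its conjugate with weights [t] and [1 - t] keeps the real part and
   multiplies the imaginary part by [2 * t - 1]. *)
suff [u [v [t [t01 uA vC uvp uvq]]]] : exists (u v : R[i]) t, [/\ 0 <= t <= 1,
    u * conjc u = A%:C, v * conjc v = C%:C,
    complex.Re (u * conjc v) = p & (2 * t - 1) * complex.Im (u * conjc v) = q].
  exists (fun i => if i == 0 then u else v), t; split=> // i j.
  move: uvp uvq; case E: (u * conjc v) => [p' r] /= ep er.
  have E' : conjc u * v = p' -i* r.
    by rewrite -[v]conjcK -rmorphM /= E.
  have e1 : ord_max = 1 :> 'I_2 by apply: val_inj.
  case: (ord2_cases i) (ord2_cases j) => -> [] ->; rewrite ?e1 /=.
  - by rewrite bA [conjc u * u]mulrC uA -mulrDl -rmorphD /= addrC subrK mul1r.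
  - rewrite bp E E'.
    by apply/eqP; rewrite eq_complex /=; apply/andP; split; apply/eqP; lra.
  - rewrite bq [v * conjc u]mulrC E' [conjc v * u]mulrC E.
    by apply/eqP; rewrite eq_complex /=; apply/andP; split; apply/eqP; lra.
  - by rewrite bC [conjc v * v]mulrC vC -mulrDl -rmorphD /= addrC subrK mul1r.
(* The general formula divides by the square root of [A]; if [A] is 0, the off-diagonal entries
   vanish. *)
have [A_eq0|A_neq0] := eqVneq A 0.
  have [p0 q0] : p = 0 /\ q = 0.
    by move: D; rewrite A_eq0 mul0r; nra.
  exists 0, (Num.sqrt C)%:C, 1; rewrite A_eq0 p0 q0 /=.
  split; rewrite ?mul0r ?ler01 ?lexx //=; last by ring.
    rewrite -{3}(sqr_sqrtr C0); apply/eqP; rewrite eq_complex /=.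
    by apply/andP; split; apply/eqP; ring.
  by ring.
have Ap : 0 < A by rewrite lt_def A_neq0.
have r2 : 0 <= A * C - p ^+ 2.
  by rewrite subr_ge0; apply: le_trans D; rewrite lerDl sqr_ge0.
pose r := Num.sqrt (A * C - p ^+ 2); pose a := Num.sqrt A.
have rr : r ^+ 2 = A * C - p ^+ 2 by rewrite sqr_sqrtr.
have r0 : 0 <= r by rewrite sqrtr_ge0.
have aa : a ^+ 2 = A by rewrite sqr_sqrtr.
have a0 : 0 < a by rewrite sqrtr_gt0.
have qr : `|q| <= r by rewrite -sqrtr_sqr ler_wsqrtr //; lra.
(* Here [u * conjc v] is [p +i* r], and [t] solves [(2 * t - 1) * r = q]; it lies in the unit
   interval because [|q| <= r]. If [r] is 0, so is [q], and [t] is 1/2 by the convention for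
   division by 0. *)
exists a%:C, ((p / a) -i* (r / a)), ((1 + q / r) / 2).
have an : a != 0 by rewrite gt_eqF.
split.
- have [r_eq0|r_neq0] := eqVneq r 0; first by rewrite r_eq0 invr0 mulr0; lra.
  have rp : 0 < r by rewrite lt_def r_neq0.
  move: qr; rewrite ler_norml => /andP[].
  rewrite -[_ <= q](ler_pM2r (x := r^-1)) ?invr_gt0 //.
  rewrite -[q <= _](ler_pM2r (x := r^-1)) ?invr_gt0 // mulNr mulfV //; lra.
- by rewrite conjc_real -rmorphM -expr2 aa.
- apply/eqP; rewrite eq_complex /=; apply/andP; split; apply/eqP; last by ring.
  rewrite (_ : _ - _ = (p ^+ 2 + r ^+ 2) / a ^+ 2); last by field.
  by rewrite rr aa; field.
- by rewrite /=; field.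
- rewrite /=; have [r_eq0|r_neq0] := eqVneq r 0.
    have : q = 0 by apply/eqP; rewrite -normr_le0 -r_eq0.
    by move=> ->; rewrite r_eq0; lra.
  by field; rewrite an.
Qed.

End Factorization.

(** * Coordinate functionals after a linear map *)

Section Coordinates.
Variables (R : realType) (n p : nat) (X : {vspace 'rV[R[i]]_n}).
Variable U : {linear 'rV[R[i]]_n -> 'rV[R[i]]_p}.

Definition coord_after (m : 'I_p) (x : subvs_of X) : (R[i])^o :=
  U (vsval x) 0 m.

Lemma coord_after_linear m : linear (coord_after m).
Proof. by move=> z x y; rewrite /coord_after !linearP !mxE. Qed.

HB.instance Definition _ m :=
  GRing.isLinear.Build R[i] (subvs_of X) (R[i])^o *:%R (coord_after m)
    (coord_after_linear m).

End Coordinates.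

(** * Planes with real coefficients, and the equation of a plane *)

Section Plane.
Variables (R : realType) (X : {vspace 'rV[R[i]]_3}).

(** The three coordinates after [U] norm the space because [U] is isometric, and they are real on
    the basis because [a1] and [a2] are. *)
Lemma real_standard_basis_property_Q (e : 2.-tuple (subvs_of X))
    (U : {linear 'rV[R[i]]_3 -> 'rV[R[i]]_3}) (a1 a2 : R) :
  (forall x, `|U x| = `|x|) ->
  U (vsval (tnth e ord0)) = vec3 1 0 a1%:C ->
  U (vsval (tnth e ord_max)) = vec3 0 1 a2%:C ->
  property_Q e.
Proof.
move=> Uiso Ue0 Ue1 b /psd2_factor[z [t [t01 bE]]].
pose f m : dual X := linfun (coord_after U m).
have fE m x : f m x = U (vsval x) 0 m by rewrite lfunE.
have normU x : subnorm x = rnorm (U (vsval x)) by rewrite /rnorm Uiso.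
apply: (@real_norming_norms_eq _ _ _ _ _ _ _ f (tnth e ord0) z t) => //.
- move=> m i; rewrite fE; apply/eqP.
  by case: (ord2_cases i) => ->; rewrite (Ue0, Ue1) mxE;
    case: m => [[|[|[|//]]]] ?; rewrite eq_complex /= ?oppr0 !eqxx.
- by move=> m x; rewrite fE normU; apply: mx_rnorm_le.
- move=> x; rewrite normU; set y := U _.
  have [y0|/mx_norm_neq0[[i m] /= ym]] := eqVneq (mx_norm y) 0.
    have {}y0 : y = 0 by apply: mx_norm_eq0.
    by exists 0; rewrite fE -/y y0 mxE /rnorm !normr0.
  by exists m; rewrite fE -/y /rnorm -[`|y|]/(mx_norm y) ym (ord1 i).
- apply: contraTneq isT => e0; move: Ue0; rewrite e0 !linear0.
  by move/matrixP/(_ 0 0); rewrite !mxE /= => /esym/eqP; rewrite oner_eq0.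
Qed.

(** A matrix with two rows and three columns has a nonzero cokernel. The kernel of the resulting
    functional contains [X] and, by rank-nullity, has dimension at most 2. *)
Lemma plane_equation : \dim X = 2%N ->
  exists2 c : 'cV[R[i]]_3, c != 0 & forall x, (x \in X) = (x *m c == 0).
Proof.
move=> dimX; pose A := \matrix_(i < \dim X) (vbasis X)`_i.
have [c c0 Ac] : exists2 c : 'cV[R[i]]_3, c != 0 & A *m c = 0.
  have : cokermx A != 0.
    rewrite -mxrank_eq0 mxrank_coker -lt0n subn_gt0.
    by apply: leq_ltn_trans (rank_leq_row _) _; rewrite dimX.
  case/matrix0Pn => i [j ij]; exists (col j (cokermx A)).
    by apply/cV0Pn; exists i; rewrite mxE.
  by rewrite colE mulmxA mulmx_coker mul0mx.
exists c => //.
pose g := linfun (mulmxr c : 'rV[R[i]]_3 -> 'rV[R[i]]_1).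
have gE x : (x \in lker g) = (x *m c == 0) by rewrite memv_ker lfunE.
suff /eqP -> : X == lker g by [].
rewrite eqEdim; apply/andP; split.
  apply/subvP => x xX; rewrite gE (coord_vbasis xX) mulmx_suml big1 // => i _.
  have /(congr1 (row i)) := Ac; rewrite row_mul rowK linear0 => ci.
  by rewrite -scalemxAl ci scaler0.
have := limg_ker_dim g fullv; rewrite capfv dimvf /= => dg.
have : (0 < \dim (limg g))%N.
  rewrite lt0n dimv_eq0; case/cV0Pn: c0 => i ci; apply: contraNneq ci => g0.
  have : g (delta_mx 0 i) \in limg g by rewrite memv_img // memvf.
  rewrite g0 memv0 lfunE /= -rowE => /eqP/matrixP/(_ 0 0).
  by rewrite !mxE => ->.
rewrite dimX; move: dg; rewrite (_ : dim _ = 3%N) //.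
case: (\dim (limg g)) => // d.
by rewrite addnS => -[dg] _; rewrite (leq_trans (leq_addr d _)) // dg.
Qed.

End Plane.

(** * Phases and coordinate permutations *)

Section StandardBasis.
Variable R : realType.

Lemma phase (u : R[i]) : exists2 v : R[i], `|v| = 1 & v * u = (rnorm u)%:C.
Proof.
have [->|u0] := eqVneq u 0.
  by exists 1; rewrite ?normr1 // mulr0 /rnorm normr0.
exists (`|u| / u).
  by rewrite normrM normrV ?unitfE // normr_id mulfV ?normr_eq0.
by rewrite divfK // rnormC.
Qed.

Definition monomial_fun n (v : 'I_n -> R[i]) (s : {perm 'I_n})
    (x : 'rV[R[i]]_n) : 'rV[R[i]]_n := \row_j (v j * x 0 (s j)).

Lemma monomial_fun_linear n (v : 'I_n -> R[i]) s : linear (monomial_fun v s).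
Proof.
by move=> a x y; apply/rowP => j; rewrite !mxE mulrDr mulrCA.
Qed.

HB.instance Definition _ n (v : 'I_n -> R[i]) s :=
  GRing.isLinear.Build R[i] 'rV[R[i]]_n 'rV[R[i]]_n *:%R (monomial_fun v s)
    (monomial_fun_linear v s).

Lemma monomial_fun_norm n (v : 'I_n -> R[i]) s (x : 'rV[R[i]]_n) :
  (forall j, `|v j| = 1) -> `|monomial_fun v s x| = `|x|.
Proof.
move=> v1; rewrite -!rnormC; congr _%:C.
have vE j : rnorm (monomial_fun v s x 0 j) = rnorm (x 0 (s j)).
  by rewrite mxE rnormM [X in X * _](_ : _ = 1) ?mul1r // /rnorm v1.
apply: le_anti; rewrite !mx_rnorm_ub ?rnorm_ge0 // => i j; rewrite (ord1 i).
  by rewrite -[j](permKV s) -vE mx_rnorm_le.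
by rewrite vE mx_rnorm_le.
Qed.

End StandardBasis.

(** * Normalization of the defining equation *)

Theorem corollary3p9 (R : realType) (X : {vspace 'rV[R[i]]_3})
    (dimX : \dim X = 2%N) :
  exists e : 2.-tuple (subvs_of X), standard_basis e /\ property_Q e.
Proof.
have [c /cV0Pn[k ck] Xc] := plane_equation dimX.
(* The transposition moves a nonzero coefficient to the last place, so that the equation can be
   solved for the last coordinate. *)
pose s := tperm k ord_max; pose d j := c (s j) 0.
have d2 : d ord_max != 0 by rewrite /d /s tpermR.
pose i0 : 'I_3 := ord0; pose i1 : 'I_3 := inord 1.
(* Solving expresses the last coordinate with the coefficients [- d j / d ord_max]; rotating the
   first two coordinates turns these into their moduli [a1] and [a2]. *)
have [v0 v0n v0E] := phase (- d i0 / d ord_max).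
have [v1 v1n v1E] := phase (- d i1 / d ord_max).
set a1 := rnorm _ in v0E; set a2 := rnorm _ in v1E.
pose v := fun j : 'I_3 => [:: v0; v1; 1]`_j.
have vn j : `|v j| = 1 by case: j => [[|[|[|//]]]] ? /=; rewrite ?normr1.
have v_neq0 j : v j != 0 by rewrite -normr_eq0 vn oner_neq0.
have vVn j : `|(v j)^-1| = 1 by rewrite normfV vn invr1.
pose U : {linear 'rV[R[i]]_3 -> 'rV[R[i]]_3} :=
  monomial_fun (fun j => (v j)^-1) s.
(* [W] inverts [U], as [s] is an involution; it carries the normalized basis vectors back into
   [X]. *)
pose W (y : 'rV[R[i]]_3) : 'rV[R[i]]_3 := \row_j (v (s j) * y 0 (s j)).
have UW y : U (W y) = y.
  by apply/rowP => j; rewrite !mxE /s tpermK mulrA mulVf ?mul1r.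
have WX y : (W y \in X) = (\sum_j v j * y 0 j * d j == 0).
  have -> : \sum_j v j * y 0 j * d j = (W y *m c) 0 0.
    rewrite mxE [RHS](reindex_inj (perm_inj (s := s))); apply: eq_bigr => j _.
    by rewrite mxE /s tpermK.
  rewrite Xc; apply/eqP/eqP => [->|W0]; first by rewrite mxE.
  by rewrite [LHS]mx11_scalar W0 raddf0.
have sum3 (y : 'rV[R[i]]_3) : \sum_j v j * y 0 j * d j =
    v0 * y 0 i0 * d i0 + (v1 * y 0 i1 * d i1 + y 0 ord_max * d ord_max).
  rewrite !big_ord_recl big_ord0 addr0 /v /=.
  have -> : lift ord0 ord0 = i1 by apply: val_inj; rewrite /= inordK.
  have -> : lift ord0 (lift ord0 ord0) = ord_max :> 'I_3 by apply: val_inj.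
  by rewrite mul1r.
have e0X : W (vec3 1 0 a1%:C) \in X.
  rewrite WX sum3 !mxE /= inordK //= mulr1 mulr0 mul0r add0r -v0E.
  by apply/eqP; field.
have e1X : W (vec3 0 1 a2%:C) \in X.
  rewrite WX sum3 !mxE /= inordK //= mulr1 mulr0 mul0r add0r -v1E.
  by apply/eqP; field.
pose e := [tuple Subvs e0X; Subvs e1X].
have Ue0 : U (vsval (tnth e ord0)) = vec3 1 0 a1%:C by rewrite UW.
have Ue1 : U (vsval (tnth e ord_max)) = vec3 0 1 a2%:C by rewrite UW.
have Uiso x : `|U x| = `|x| by apply: monomial_fun_norm.
exists e; split; last exact: (real_standard_basis_property_Q Uiso Ue0 Ue1).
split; last by exists U, a1%:C, a2%:C.
rewrite basisEfree subvf dimvf size_tuple /=; apply/andP; split; last first.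
  by rewrite (_ : dim _ = \dim X) // dimX.
(* After [U], the first two coordinates of a combination are its coefficients. *)
apply/freeP => z /(congr1 (fun x => U (vsval x))).
rewrite !big_ord_recl big_ord0 addr0 !(linearD, linearZ, linear0) /= !UW => ze.
move=> i; have [->|->] := ord2_cases i.
- move/matrixP/(_ 0 i0): ze.
  by rewrite !mxE /= mulr1 mulr0 addr0.
- rewrite (_ : ord_max = lift ord0 ord0); last exact: val_inj.
  move/matrixP/(_ 0 i1): ze.
  by rewrite !mxE /= inordK //= mulr1 mulr0 add0r.
Qed.
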